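(* For any computable, nondecreasing, unbounded function $f:\omega\to\omega$ there is an $f$-c.e. set $B$ that has an asymptotic density, but such that for every $n \in \omega$ the real $\rho(B)$ is not the asymptotic density of any $n$-c.e. set.
   Context: For $X \subseteq \omega=\{0,1,2,\dots\}$ and an integer $m>0$, let $\rho_m(X) = |\{j \in X : j < m\}|/m$. The set $X$ has a (asymptotic) density if $\lim_m \rho_m(X)$ exists, and the density is then $\rho(X) = \lim_m \rho_m(X)$. Sets are identified with their characteristic functions. For a function $f:\omega\to\omega$, a set $A \subseteq \omega$ is $f$-c.e. if there is a computable function $g:\omega\times\omega\to\{0,1\}$ such that for all $x$: $g(x,0)=0$, $A(x)=\lim_s g(x,s)$, and $|\{s : g(x,s) \neq g(x,s+1)\}| \leq f(x)$. For $n\in\omega$, a set is $n$-c.e. if it is $c_n$-c.e., where $c_n$ is the constant function with value $n$. *)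

(* Defs.v *)
From HB Require Import structures.
From mathcomp Require Import all_boot all_order all_algebra.
From mathcomp Require Import all_classical all_reals all_analysis.

Set Implicit Arguments.
Unset Strict Implicit.
Unset Printing Implicit Defensive.

Import numFieldNormedType.Exports.

Local Open Scope nat_scope.
Local Open Scope classical_set_scope.

(* The total recursive functions of several variables: the least class of
   functions [nat ^ k -> nat] that contains zero, successor and the projections
   and is closed under composition, primitive recursion (on the first argument)
   and minimization of functions that have a zero for all parameters.  By
   Kleene's normal form theorem these are exactly the total functions computed
   by a Turing machine. *)
Inductive recursive : forall k : nat, (k.-tuple nat -> nat) -> Prop :=
| recursive_zero : recursive (fun _ : 0.-tuple nat => 0)
| recursive_succ : recursive (fun v : 1.-tuple nat => (tnth v ord0).+1)
| recursive_proj k (i : 'I_k) : recursive (fun v : k.-tuple nat => tnth v i)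
| recursive_comp k m (h : m.-tuple nat -> nat)
    (g : 'I_m -> k.-tuple nat -> nat) :
    recursive h -> (forall i, recursive (g i)) ->
    recursive (fun v : k.-tuple nat => h [tuple g i v | i < m])
| recursive_prec k (g : k.-tuple nat -> nat) (h : k.+2.-tuple nat -> nat) :
    recursive g -> recursive h ->
    recursive (fun v : k.+1.-tuple nat =>
      iteri (thead v) (fun i r => h [tuple of i :: r :: behead_tuple v])
        (g (behead_tuple v)))
| recursive_mu k (g : k.+1.-tuple nat -> nat)
    (g0 : forall v : k.-tuple nat, exists y, g [tuple of y :: v] == 0) :
    recursive g ->
    recursive (fun v : k.-tuple nat => ex_minn (g0 v)).

Definition computable1 (f : nat -> nat) : Prop :=
  recursive (fun v : 1.-tuple nat => f (tnth v ord0)).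

Definition computable2 (g : nat -> nat -> nat) : Prop :=
  recursive (fun v : 2.-tuple nat => g (tnth v ord0) (tnth v ord_max)).

Definition is_fce (f : nat -> nat) (A : pred nat) : Prop :=
  exists g : nat -> nat -> bool,
    computable2 (fun x s => nat_of_bool (g x s)) /\
    forall x : nat,
      [/\ g x 0 = false,
          \forall s \near \oo, g x s = A x &
          ([set s | g x s <> g x s.+1] #<= `I_(f x))%card].

Definition is_nce (n : nat) (A : pred nat) : Prop := is_fce (fun _ => n) A.

Section Density.
Variable R : realType.
Local Open Scope ring_scope.

(* At [m = 0] the value is the junk value [0 / 0 = 0]; limits ignore it. *)
Definition partial_density (X : pred nat) (m : nat) : R :=
  #|[pred j : 'I_m | X j]|%:R / m%:R.

Definition has_density (X : pred nat) : Prop :=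
  cvgn (partial_density X).

(* Meaningful only when [has_density X] holds. *)
Definition density (X : pred nat) : R := limn (partial_density X).

End Density.

(* Main.v *)
(** The density of an [n]-c.e. set [A] is [lim_m (N_0 m - N_1 m) / m], where
    [N_0 m] and [N_1 m] are the limits of the nondecreasing numbers of switches
    on and off below [m], both at most [n * m].  Rounded to a fixed precision
    [1 / D], the sequences [sup_(m >= k) (N_i m / m)] are integers that decrease
    with [k], hence become constant, and each is the limit of a nondecreasing
    computable approximation with at most [n * D] values.  So a rational
    [(p - q) / D] within [1 / D] of the density of [A] is found as a double limit
    in which, for each [k], the inner limit changes at most [2 * n * D] times.

    A universal machine does this uniformly for the [e]-th pair of a program and
    a bound, with [D = 5 ^ e.+1], and Cantor's diagonal argument in base 5 yields
    digits [b_e] such that [sum_e b_e / 5 ^ e.+1] avoids all these densities.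
    This is the density of the set [B] of the [x] whose last nonzero base 5 digit,
    in position [e], is at most [b_e], where [b_e] is approximated with [k = x].
    The number of changes at [x] depends on [e] only, and so it exceeds [f x] for
    finitely many [x] with the given [e]; these are left out of [B]. *)

Require Import Defs.
From HB Require Import structures.
From mathcomp Require Import all_boot all_order all_algebra.
From mathcomp Require Import all_classical all_reals all_analysis.
From mathcomp Require Import zify ring lra.

Set Implicit Arguments.
Unset Strict Implicit.
Unset Printing Implicit Defensive.

Local Open Scope nat_scope.

(** * Closure properties of the recursive functions *)

(** Arguments come as a list, so that arities need no dependent types and a variable is [nth 0 l i];
    only lists of length [k] count. *)
Definition rec_in (k : nat) (F : seq nat -> nat) : Prop :=
  recursive (fun v : k.-tuple nat => F v).

Lemma recursive_ext k (F G : k.-tuple nat -> nat) :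
  F =1 G -> recursive F -> recursive G.
Proof. by move=> /funext ->. Qed.

Lemma rec_in_ext k (F G : seq nat -> nat) :
  (forall l, size l = k -> F l = G l) -> rec_in k F -> rec_in k G.
Proof. by move=> FG; apply: recursive_ext => v; rewrite FG ?size_tuple. Qed.

Lemma rec_in_var k i : i < k -> rec_in k (fun l => nth 0 l i).
Proof.
move=> ik; apply: recursive_ext (recursive_proj (Ordinal ik)) => v.
by rewrite (tnth_nth 0).
Qed.

Lemma rec_in_comp k H (Gs : seq (seq nat -> nat)) :
  rec_in (size Gs) H ->
  (forall i, i < size Gs -> rec_in k (nth (fun=> 0) Gs i)) ->
  rec_in k (fun l => H [seq G l | G <- Gs]).
Proof.
move=> rH rG.
apply: recursive_ext
  (recursive_comp (g := fun (i : 'I_(size Gs)) v => nth (fun=> 0) Gs i v) rH _).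
  move=> v; congr H; apply: (@eq_from_nth _ 0) => [|i].
    by rewrite size_tuple size_map.
  rewrite size_tuple => iG; rewrite (nth_map (fun=> 0)) //.
  by rewrite -[i]/(val (Ordinal iG)) -tnth_nth tnth_mktuple.
by move=> i; apply: rG.
Qed.

Lemma rec_in_const k c : rec_in k (fun=> c).
Proof.
elim: c => [|c IHc].
  apply: recursive_ext
    (recursive_comp (g := fun (i : 'I_0) (_ : k.-tuple nat) => 0) recursive_zero _)
    => // -[].
  by [].
apply: recursive_ext
  (recursive_comp (g := fun=> _) recursive_succ (fun=> IHc)) => v /=.
by rewrite tnth_mktuple.
Qed.

Lemma rec_in_op1 (op : nat -> nat) k A :
  rec_in 1 (fun l => op (nth 0 l 0)) -> rec_in k A ->
  rec_in k (fun l => op (A l)).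
Proof. by move=> rop rA; apply: (rec_in_comp (Gs := [:: A]) rop) => -[]. Qed.

Lemma rec_in_op2 (op : nat -> nat -> nat) k A B :
  rec_in 2 (fun l => op (nth 0 l 0) (nth 0 l 1)) -> rec_in k A -> rec_in k B ->
  rec_in k (fun l => op (A l) (B l)).
Proof.
by move=> rop rA rB; apply: (rec_in_comp (Gs := [:: A; B]) rop) => -[|[|]].
Qed.

Lemma rec_in_succ k A : rec_in k A -> rec_in k (fun l => (A l).+1).
Proof.
apply: (rec_in_op1 (op := succn)); apply: recursive_ext recursive_succ => v.
by rewrite (tnth_nth 0).
Qed.

(** Primitive recursion is bounded by the first argument; composing with [N] followed by all the
    projections allows any bound and keeps the parameters. *)
Lemma rec_in_iteri k N G H :
  rec_in k N -> rec_in k G -> rec_in k.+2 H ->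
  rec_in k (fun l => iteri (N l) (fun i r => H [:: i, r & l]) (G l)).
Proof.
move=> rN rG rH.
have rI : rec_in k.+1 (fun l =>
    iteri (head 0 l) (fun i r => H [:: i, r & behead l]) (G (behead l))).
  apply: recursive_ext (recursive_prec rG rH) => v.
  by case/tupleP: v => x v; rewrite theadE.
pose Gs := N :: [seq (fun l => nth 0 l i) | i <- iota 0 k].
have sGs : size Gs = k.+1 by rewrite /= size_map size_iota.
rewrite -sGs in rI; apply: rec_in_ext (rec_in_comp rI _).
  move=> l sl; rewrite /Gs -sl /=.
  have -> // : [seq G l | G <- [seq nth 0^~ i | i <- iota 0 (size l)]] = l.
    by rewrite -map_comp -[RHS](mkseq_nth 0).
move=> [|i]; rewrite sGs ltnS //= => ik.
rewrite (nth_map 0) ?size_iota // nth_iota //.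
exact: rec_in_var.
Qed.

Lemma rec_in_weaken k F :
  rec_in k.+1 F -> rec_in k.+2 (fun l => F (nth 0 l 0 :: behead (behead l))).
Proof.
move=> rF; pose Gs := [seq (fun l => nth 0 l i) | i <- 0 :: iota 2 k].
have sGs : size Gs = k.+1 by rewrite /= size_map size_iota.
rewrite -sGs in rF; apply: rec_in_ext (rec_in_comp rF _).
  move=> [|x [|y l]] //= [<-]; congr (F (_ :: _)).
  rewrite -map_comp -[RHS](mkseq_nth 0) /mkseq (iotaDl 2 0) -map_comp.
  exact: eq_map.
move=> i; rewrite sGs => ik; rewrite (nth_map 0) /= ?size_iota //.
apply: rec_in_var; case: i ik => // i; rewrite ltnS => ik /=.
by rewrite nth_iota // !ltnS.
Qed.

Lemma rec_in_pred k A : rec_in k A -> rec_in k (fun l => (A l).-1).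
Proof.
apply: (rec_in_op1 (op := predn)).
apply: rec_in_ext (rec_in_iteri (H := fun l => nth 0 l 0)
  (rec_in_var (i := 0) _)  (rec_in_const _ 0) (rec_in_var _)) => // l _.
by case: (nth 0 l 0) => //= n; elim: n.
Qed.

Lemma rec_in_add k A B : rec_in k A -> rec_in k B -> rec_in k (fun l => A l + B l).
Proof.
apply: (rec_in_op2 (op := addn)).
apply: rec_in_ext (rec_in_iteri (H := fun l => (nth 0 l 1).+1)
  (rec_in_var (i := 1) _) (rec_in_var (i := 0) _) (rec_in_succ (rec_in_var _)))
  => // l _.
by elim: (nth 0 l 1) => /= [|n ->]; rewrite ?addn0 ?addnS.
Qed.

Lemma rec_in_sub k A B : rec_in k A -> rec_in k B -> rec_in k (fun l => A l - B l).
Proof.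
apply: (rec_in_op2 (op := subn)).
apply: rec_in_ext (rec_in_iteri (H := fun l => (nth 0 l 1).-1)
  (rec_in_var (i := 1) _) (rec_in_var (i := 0) _) (rec_in_pred (rec_in_var _)))
  => // l _.
by elim: (nth 0 l 1) => /= [|n ->]; rewrite ?subn0 ?subnS.
Qed.

Lemma rec_in_foldi (op : nat -> nat -> nat) idx k N F :
  rec_in 2 (fun l => op (nth 0 l 0) (nth 0 l 1)) ->
  rec_in k N -> rec_in k.+1 F ->
  rec_in k (fun l => iteri (N l) (fun i r => op r (F (i :: l))) idx).
Proof.
move=> rop rN rF.
apply: (rec_in_iteri
  (H := fun l => op (nth 0 l 1) (F (nth 0 l 0 :: behead (behead l)))) rN).
  exact: rec_in_const.
by apply: (rec_in_op2 rop); [exact: rec_in_var | exact: rec_in_weaken].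
Qed.

Lemma rec_in_sum k N F : rec_in k N -> rec_in k.+1 F ->
  rec_in k (fun l => \sum_(i < N l) F (nat_of_ord i :: l)).
Proof.
move=> rN rF; apply: rec_in_ext (rec_in_foldi 0 _ rN rF) => [l _|].
  by elim: (N l) => [|n IHn]; rewrite ?big_ord0 // big_ord_recr -IHn.
by apply: rec_in_add; apply: rec_in_var.
Qed.

Lemma rec_in_maxn k A B :
  rec_in k A -> rec_in k B -> rec_in k (fun l => maxn (A l) (B l)).
Proof.
move=> rA rB; apply: rec_in_ext (rec_in_add rA (rec_in_sub rB rA)) => l _.
by rewrite -maxnE.
Qed.

Lemma rec_in_minn k A B :
  rec_in k A -> rec_in k B -> rec_in k (fun l => minn (A l) (B l)).
Proof.
move=> rA rB; apply: rec_in_ext (rec_in_sub rA (rec_in_sub rA rB)) => l _.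
by rewrite -minnE.
Qed.

Lemma rec_in_bigmax k N F : rec_in k N -> rec_in k.+1 F ->
  rec_in k (fun l => \max_(i < N l) F (nat_of_ord i :: l)).
Proof.
move=> rN rF; apply: rec_in_ext (rec_in_foldi 0 _ rN rF) => [l _|].
  by elim: (N l) => [|n IHn]; rewrite ?big_ord0 // big_ord_recr -IHn.
by apply: rec_in_maxn; apply: rec_in_var.
Qed.

Lemma rec_in_mul k A B : rec_in k A -> rec_in k B -> rec_in k (fun l => A l * B l).
Proof.
apply: (rec_in_op2 (op := muln)).
apply: rec_in_ext (rec_in_sum (rec_in_var (i := 1) _)
  (rec_in_var (k := 3) (i := 1) _)) => // l _ /=.
by rewrite sum_nat_const card_ord mulnC.
Qed.

Lemma rec_in_exp k A B : rec_in k A -> rec_in k B -> rec_in k (fun l => A l ^ B l).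
Proof.
apply: (rec_in_op2 (op := expn)).
apply: rec_in_ext (rec_in_iteri (H := fun l => nth 0 l 1 * nth 0 l 2)
  (rec_in_var (i := 1) _) (rec_in_const _ 1)
  (rec_in_mul (rec_in_var _) (rec_in_var _))) => // l _ /=.
by elim: (nth 0 l 1) => //= n ->; rewrite expnSr.
Qed.

Lemma rec_in_leq k A B : rec_in k A -> rec_in k B -> rec_in k (fun l => A l <= B l).
Proof.
move=> rA rB.
apply: rec_in_ext (rec_in_sub (rec_in_const _ 1) (rec_in_sub rA rB)) => l _.
by rewrite -subn_eq0; case: (A l - B l).
Qed.

Lemma rec_in_andb k (A B : seq nat -> bool) :
  rec_in k A -> rec_in k B -> rec_in k (fun l => A l && B l).
Proof.
by move=> rA rB; apply: rec_in_ext (rec_in_mul rA rB) => l _; rewrite mulnb.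
Qed.

Lemma rec_in_eqn k A B : rec_in k A -> rec_in k B -> rec_in k (fun l => A l == B l).
Proof.
move=> rA rB; apply: rec_in_ext (rec_in_andb (rec_in_leq rA rB)
  (rec_in_leq rB rA)) => l _.
by rewrite eqn_leq.
Qed.

Lemma rec_in_if k (C : seq nat -> bool) A B :
  rec_in k C -> rec_in k A -> rec_in k B ->
  rec_in k (fun l => if C l then A l else B l).
Proof.
move=> rC rA rB; apply: rec_in_ext (rec_in_add (rec_in_mul rC rA)
  (rec_in_mul (rec_in_sub (rec_in_const _ 1) rC) rB)) => l _.
by case: (C l); rewrite ?mul1n ?mul0n ?addn0.
Qed.

Lemma rec_in_divn k A B :
  rec_in k A -> rec_in k B -> rec_in k (fun l => A l %/ B l).
Proof.
apply: (rec_in_op2 (op := divn)).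
(* The quotient counts the [i < a] with [i.+1 * b <= a]; the factor [1 <= b] yields the value 0 of a
   division by 0. *)
apply: rec_in_ext
  (rec_in_mul (rec_in_leq (rec_in_const _ 1) (rec_in_var (i := 1) _))
  (rec_in_sum (F := fun l => (nth 0 l 0).+1 * nth 0 l 2 <= nth 0 l 1)
    (rec_in_var (i := 0) _)
    (rec_in_leq (rec_in_mul (rec_in_succ (rec_in_var _)) (rec_in_var _))
     (rec_in_var _)))) => // -[|a [|b l]] // _ /=.
case: b => [|b]; first by rewrite divn0.
rewrite mul1n -(card_ord (a %/ b.+1)) -sum1_card.
rewrite (big_ord_widen _ (fun=> 1) (leq_div a b.+1)) [RHS]big_mkcond /=.
by apply: eq_bigr => i _; rewrite leq_divRL //; case: ifP.
Qed.

Lemma rec_in_modn k A B :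
  rec_in k A -> rec_in k B -> rec_in k (fun l => A l %% B l).
Proof.
move=> rA rB.
apply: rec_in_ext (rec_in_sub rA (rec_in_mul (rec_in_divn rA rB) rB)) => l _.
by rewrite {1}(divn_eq (A l) (B l)) addKn.
Qed.

Lemma rec_in_dvdn k A B :
  rec_in k A -> rec_in k B -> rec_in k (fun l => A l %| B l).
Proof.
by move=> rA rB; apply: rec_in_eqn (rec_in_modn rB rA) (rec_in_const _ 0).
Qed.

(** * A pairing function and its inverses *)

(* Locked: unfolding it on codes of programs would compute huge unary numbers. *)
HB.lock Definition cpair (a b : nat) : nat := (a + b) ^ 2 + a.

(** Decoding by exhaustive search: components are at most the code, and at most one pair has the
    code [z]. The default is 0. *)
Definition pfst (z : nat) : nat :=
  \sum_(a < z.+1) \sum_(b < z.+1) (cpair a b == z) * a.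
Definition psnd (z : nat) : nat :=
  \sum_(a < z.+1) \sum_(b < z.+1) (cpair a b == z) * b.

(** The code is at least [(a + b) ^ 2] and less than [(a + b).+1 ^ 2], so it determines [a + b], and
    then [a]. *)
Lemma cpair_inj a b a' b' : cpair a b = cpair a' b' -> a = a' /\ b = b'.
Proof.
wlog le_ab : a b a' b' / a + b <= a' + b' => [hw eq_p|].
  have [/hw|/ltnW/hw] := leqP (a + b) (a' + b'); first exact.
  by case/(_ (esym eq_p)) => -> ->.
rewrite cpair.unlock => eq_p; have [lt_ab|ge_ab] := ltnP (a + b) (a' + b').
  have : (a + b).+1 ^ 2 <= (a' + b') ^ 2 by rewrite leq_sqr.
  by rewrite -[in (a + b).+1]addn1 sqrnD; lia.
have eq_ab : a + b = a' + b' by lia.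
by move: eq_p; rewrite eq_ab; lia.
Qed.

Lemma leq_cpair a b : (a <= cpair a b) && (b <= cpair a b).
Proof.
have : a + b <= (a + b) ^ 2.
  by rewrite -mulnn; case: (a + b) => // n; rewrite leq_pmulr.
by rewrite cpair.unlock; lia.
Qed.

Lemma sum_cpair_eq (F : nat -> nat -> nat) a b :
  \sum_(i < (cpair a b).+1) \sum_(j < (cpair a b).+1)
    (cpair i j == cpair a b) * F i j = F a b.
Proof.
have /andP[az bz] := leq_cpair a b.
rewrite (bigD1 (Ordinal (az : a < (cpair a b).+1))) //=.
rewrite (bigD1 (Ordinal (bz : b < (cpair a b).+1))) //= eqxx mul1n.
rewrite !big1 ?addn0 // => [i|j]; rewrite -val_eqE /= => ne.
  apply: big1 => j _; case: eqP => // /cpair_inj[ia].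
  by rewrite ia eqxx in ne.
by case: eqP => // /cpair_inj[_ jb]; rewrite jb eqxx in ne.
Qed.

Lemma pfstK a b : pfst (cpair a b) = a.
Proof. exact: (sum_cpair_eq (fun a _ => a)). Qed.

Lemma psndK a b : psnd (cpair a b) = b.
Proof. exact: (sum_cpair_eq (fun _ b => b)). Qed.

Lemma rec_in_cpair k A B :
  rec_in k A -> rec_in k B -> rec_in k (fun l => cpair (A l) (B l)).
Proof.
move=> rA rB; rewrite cpair.unlock; apply: rec_in_add => //.
by apply: rec_in_exp (rec_in_const _ 2); apply: rec_in_add.
Qed.

Lemma rec_in_unpair_sum (F : nat -> nat -> nat) k A :
  rec_in 2 (fun l => F (nth 0 l 0) (nth 0 l 1)) ->
  rec_in k A ->
  rec_in k (fun l => let z := A l in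
    \sum_(a < z.+1) \sum_(b < z.+1) (cpair a b == z) * F a b).
Proof.
move=> rF; apply: (rec_in_op1 (op := fun z =>
  \sum_(a < z.+1) \sum_(b < z.+1) (cpair a b == z) * F a b)).
apply: (@rec_in_sum 1 (fun l => (nth 0 l 0).+1) (fun l =>
  \sum_(b < (nth 0 l 1).+1) (cpair (nth 0 l 0) b == nth 0 l 1) * F (nth 0 l 0) b)).
  exact/rec_in_succ/rec_in_var.
apply: (@rec_in_sum 2 (fun l => (nth 0 l 1).+1) (fun l =>
  (cpair (nth 0 l 1) (nth 0 l 0) == nth 0 l 2) * F (nth 0 l 1) (nth 0 l 0))).
  exact/rec_in_succ/rec_in_var.
apply: rec_in_mul; last by apply: (rec_in_op2 rF); apply: rec_in_var.
by apply: rec_in_eqn; [apply: rec_in_cpair|]; apply: rec_in_var.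
Qed.

Lemma rec_in_pfst k A : rec_in k A -> rec_in k (fun l => pfst (A l)).
Proof. by apply: (rec_in_unpair_sum (F := fun a _ => a)); apply: rec_in_var. Qed.

Lemma rec_in_psnd k A : rec_in k A -> rec_in k (fun l => psnd (A l)).
Proof. by apply: (rec_in_unpair_sum (F := fun _ b => b)); apply: rec_in_var. Qed.

Ltac rec_in_auto :=
  lazymatch goal with
  | |- rec_in _ (fun l => nth 0 l ?i) => exact: rec_in_var
  | |- rec_in _ (fun l => if _ then _ else _) =>
      apply: rec_in_if; rec_in_auto
  | |- rec_in _ (fun l => nat_of_bool (_ == _)) =>
      apply: rec_in_eqn; rec_in_auto
  | |- rec_in _ (fun l => nat_of_bool (_ <= _)) =>
      apply: rec_in_leq; rec_in_auto
  | |- rec_in _ (fun l => nat_of_bool (_ %| _)) =>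
      apply: rec_in_dvdn; rec_in_auto
  | |- rec_in _ (fun l => nat_of_bool (_ && _)) =>
      apply: rec_in_andb; rec_in_auto
  | |- rec_in _ (fun l => cpair _ _) => apply: rec_in_cpair; rec_in_auto
  | |- rec_in _ (fun l => pfst _) => apply: rec_in_pfst; rec_in_auto
  | |- rec_in _ (fun l => psnd _) => apply: rec_in_psnd; rec_in_auto
  | |- rec_in _ (fun l => minn _ _) => apply: rec_in_minn; rec_in_auto
  | |- rec_in _ (fun l => _ %/ _) => apply: rec_in_divn; rec_in_auto
  | |- rec_in _ (fun l => _ %% _) => apply: rec_in_modn; rec_in_auto
  | |- rec_in _ (fun l => _ ^ _) => apply: rec_in_exp; rec_in_auto
  | |- rec_in _ (fun l => _ * _) => apply: rec_in_mul; rec_in_auto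
  | |- rec_in _ (fun l => _ + _) => apply: rec_in_add; rec_in_auto
  | |- rec_in _ (fun l => _ - _) => apply: rec_in_sub; rec_in_auto
  | |- rec_in _ (fun _ => ?c) => exact: (rec_in_const _ c)
  | |- rec_in _ (fun l => _.-1) => apply: rec_in_pred; rec_in_auto
  | |- rec_in _ (fun l => _.+1) => apply: rec_in_succ; rec_in_auto
  | |- _ => try assumption
  end.

(** * A stack machine and a compiler for recursive functions *)

(* A data word [cpair E S] holds an environment [E] and a stack [S].  In order:
   push 0; successor; push the head of [E]; save [E] and drop its head; return to
   the saved environment below the result; cons; call with the environment on
   top; then start, step and end of a primitive recursion, whose environment is
   [remaining :: i :: value :: args]; start, step and end of a minimization,
   whose environment is [last value :: y :: args]. *)
Definition ops : seq (nat -> nat -> nat) := [::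
  fun E S => cpair E (cpair 0 S);
  fun E S => cpair E (cpair (pfst E).+1 S);
  fun E S => cpair E (cpair (pfst E) S);
  fun E S => cpair (psnd E) (cpair E S);
  fun E S => cpair (pfst (psnd S)) (cpair (pfst S) (psnd (psnd S)));
  fun E S => cpair E (cpair (cpair (pfst S) (pfst (psnd S))) (psnd (psnd S)));
  fun E S => cpair (pfst S) (cpair E (psnd S));
  fun E S => let E0 := pfst (psnd S) in
    cpair (cpair (pfst E0) (cpair 0 (cpair (pfst S) (psnd E0)))) (psnd S);
  fun E S => let E0 := pfst (psnd S) in
    cpair (cpair (pfst E0).-1 (cpair (pfst (psnd E0)).+1
      (cpair (pfst S) (psnd (psnd (psnd E0)))))) (psnd (psnd S));
  fun E S => cpair (pfst S) (cpair (pfst (psnd (psnd E))) (psnd S));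
  fun E S => cpair (cpair 1 (cpair 0 E)) (cpair E S);
  fun E S => let E0 := pfst (psnd S) in
    cpair (cpair (pfst S) (cpair (pfst (psnd E0) + (0 < pfst S)) (psnd (psnd E0))))
      (psnd (psnd S));
  fun E S => cpair (pfst S) (cpair (pfst (psnd E)) (psnd S))].

Definition op (j d : nat) : nat := nth (fun _ _ => 0) ops j (pfst d) (psnd d).

(* A state is [cpair K d], where the control stack [K] is a list of instructions
   coded by [0] for the empty list and [(cpair i K).+1] for [i :: K].
   The instruction [cpair 0 (cpair p q)] runs [p] then [q],
   [cpair 1 p] runs [p] as long as the environment has a nonzero head, and
   [cpair j.+2 _] applies the [j]-th operation. *)
Definition step (st : nat) : nat :=
  let K := pfst st in let d := psnd st in
  let i := pfst K.-1 in let K' := psnd K.-1 in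
  let p := psnd i in
  if K == 0 then st
  else if pfst i == 0 then cpair (cpair (pfst p) (cpair (psnd p) K').+1).+1 d
  else if pfst i == 1 then
    if pfst (pfst d) == 0 then cpair K' d else cpair (cpair p K).+1 d
  else cpair K' (op (pfst i).-2 d).

(** The quantifier over the remaining control stack [K] is what lets runs be composed. *)
Definition cmd (p d d' : nat) : Prop :=
  forall K, exists n, iter n step (cpair (cpair p K).+1 d) = cpair K d'.

Lemma cmd_op j d : cmd (cpair j.+2 0) d (op j d).
Proof. by move=> K; exists 1; rewrite /= /step !(pfstK, psndK). Qed.

Lemma cmd_seq p q d d' d'' :
  cmd p d d' -> cmd q d' d'' -> cmd (cpair 0 (cpair p q)) d d''.
Proof.
move=> cp cq K; have [n en] := cp (cpair q K).+1; have [m em] := cq K.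
by exists (m + (n + 1)); rewrite !iterD /= {3}/step !(pfstK, psndK) /= en.
Qed.

Lemma cmd_while0 p E S : pfst E = 0 -> cmd (cpair 1 p) (cpair E S) (cpair E S).
Proof. by move=> E0 K; exists 1; rewrite /= /step !(pfstK, psndK) /= E0. Qed.

Lemma cmd_whileS p E S d d' : pfst E <> 0 ->
  cmd p (cpair E S) d -> cmd (cpair 1 p) d d' -> cmd (cpair 1 p) (cpair E S) d'.
Proof.
move=> /eqP/negPf E0 cp cw K; have [n en] := cp (cpair (cpair 1 p) K).+1.
have [m em] := cw K; exists (m + (n + 1)).
by rewrite !iterD /= {3}/step !(pfstK, psndK) /= E0 en.
Qed.

Definition code (l : seq nat) : nat := foldr cpair 0 l.

Definition computes (p E y : nat) : Prop :=
  forall S, cmd p (cpair E S) (cpair E (cpair y S)).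

Lemma cmd_op_eq j d d' : op j d = d' -> cmd (cpair j.+2 0) d d'.
Proof. by move=> <-; exact: cmd_op. Qed.

Definition cpairK := (pfstK, psndK).

Lemma compile_proj i :
  exists p, forall l, i < size l -> computes p (code l) (nth 0 l i).
Proof.
elim: i => [|i [p IHp]].
  exists (cpair 4 0) => -[//|x l] _ S; apply: cmd_op_eq.
  by rewrite /op /= !cpairK.
exists (cpair 0 (cpair (cpair 5 0) (cpair 0 (cpair p (cpair 6 0))))) => -[//|x l] il S.
apply: (cmd_seq (d' := cpair (code l) (cpair (code (x :: l)) S))).
  by apply: cmd_op_eq; rewrite /op /= !cpairK.
apply: cmd_seq (IHp l il _) _.
by apply: cmd_op_eq; rewrite /op /= !cpairK.
Qed.

Lemma compile_args k m (g : 'I_m -> k.-tuple nat -> nat) (s : seq 'I_m) :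
  (forall i, exists p, forall v : k.-tuple nat, computes p (code v) (g i v)) ->
  exists p, forall v : k.-tuple nat,
    computes p (code v) (code [seq g i v | i <- s]).
Proof.
move=> cg; elim: s => [|i s [q IHq]].
  by exists (cpair 2 0) => v S; apply: cmd_op_eq; rewrite /op /= !cpairK.
have [p cp] := cg i.
exists (cpair 0 (cpair q (cpair 0 (cpair p (cpair 7 0))))) => v S.
apply: cmd_seq (IHq v _) _; apply: cmd_seq (cp v _) _.
by apply: cmd_op_eq; rewrite /op /= !cpairK.
Qed.

Lemma compile_prec k (g : k.-tuple nat -> nat) (h : k.+2.-tuple nat -> nat) p q :
  (forall v : k.-tuple nat, computes p (code v) (g v)) ->
  (forall v : k.+2.-tuple nat, computes q (code v) (h v)) ->
  exists r, forall v : k.+1.-tuple nat, computes r (code v)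
    (iteri (thead v) (fun i r => h [tuple of i :: r :: behead_tuple v])
        (g (behead_tuple v))).
Proof.
move=> cg ch.
pose body := cpair 0 (cpair (cpair 5 0) (cpair 0 (cpair q (cpair 10 0)))).
exists (cpair 0 (cpair (cpair 5 0) (cpair 0 (cpair p (cpair 0 (cpair (cpair 9 0)
  (cpair 0 (cpair (cpair 1 body) (cpair 11 0))))))))).
move=> v0 S; case/tupleP: v0 => n v; rewrite theadE.
have -> : behead_tuple [tuple of n :: v] = v by exact: val_inj.
rewrite /= -/(code v).
apply: (cmd_seq (d' := cpair (code v) (cpair (cpair n (code v)) S))).
  by apply: cmd_op_eq; rewrite /op /= !cpairK.
apply: cmd_seq (cg v _) _.
apply: (cmd_seq (d' := cpair (cpair n (cpair 0 (cpair (g v) (code v))))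
  (cpair (cpair n (code v)) S))).
  by apply: cmd_op_eq; rewrite /op /= !cpairK.
pose f i r := h [tuple of i :: r :: v].
(* Loop invariant: [a] rounds remain, [b] are done, and the third entry of the environment is the
   value after [b] rounds. *)
have loop a b : cmd (cpair 1 body)
    (cpair (cpair a (cpair b (cpair (iteri b f (g v)) (code v))))
      (cpair (cpair n (code v)) S))
    (cpair (cpair 0 (cpair (a + b) (cpair (iteri (a + b) f (g v)) (code v))))
      (cpair (cpair n (code v)) S)).
  elim: a b => [|a IHa] b; first by apply: cmd_while0; rewrite cpairK.
  apply: cmd_whileS; first by rewrite cpairK.
    rewrite /body.
    apply: (cmd_seq (d' := cpair (cpair b (cpair (iteri b f (g v)) (code v)))
      (cpair (cpair a.+1 (cpair b (cpair (iteri b f (g v)) (code v))))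
        (cpair (cpair n (code v)) S)))).
      by apply: cmd_op_eq; rewrite /op /= !cpairK.
    apply: cmd_seq (ch [tuple of b :: iteri b f (g v) :: v] _) _.
    by apply: cmd_op.
  by rewrite /op /= !cpairK addSn; have := IHa b.+1; rewrite addnS.
apply: cmd_seq (loop n 0) _.
by apply: cmd_op_eq; rewrite /op /= !cpairK addn0.
Qed.

Lemma compile_mu k (g : k.+1.-tuple nat -> nat)
    (g0 : forall v : k.-tuple nat, exists y, g [tuple of y :: v] == 0) p :
  (forall v : k.+1.-tuple nat, computes p (code v) (g v)) ->
  exists r, forall v : k.-tuple nat, computes r (code v) (ex_minn (g0 v)).
Proof.
move=> cg.
pose body := cpair 0 (cpair (cpair 5 0) (cpair 0 (cpair p (cpair 13 0)))).
exists (cpair 0 (cpair (cpair 12 0) (cpair 0 (cpair (cpair 1 body) (cpair 14 0))))) => v S.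
(* The initial last value 1 is a dummy that forces the first round. The candidate advances only
   after a nonzero value, so it stops on the zero itself. *)
apply: (cmd_seq (d' := cpair (cpair 1 (cpair 0 (code v))) (cpair (code v) S))).
  by apply: cmd_op_eq; rewrite /op /= !cpairK.
case: ex_minnP => y /eqP gy0 ymin.
have run b z : z <> 0 -> forall d',
    cmd (cpair 1 body) (cpair (cpair (g [tuple of b :: v])
      (cpair (b + (0 < g [tuple of b :: v])) (code v))) (cpair (code v) S)) d' ->
    cmd (cpair 1 body) (cpair (cpair z (cpair b (code v))) (cpair (code v) S)) d'.
  move=> z0 d' cb; apply: cmd_whileS cb; first by rewrite cpairK.
  apply: (cmd_seq (d' := cpair (cpair b (code v))
    (cpair (cpair z (cpair b (code v))) (cpair (code v) S)))).
    by apply: cmd_op_eq; rewrite /op /= !cpairK.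
  apply: cmd_seq (cg [tuple of b :: v] _) _.
  by apply: cmd_op_eq; rewrite /op /= !cpairK.
have loop a b z : b + a = y -> z <> 0 -> cmd (cpair 1 body)
    (cpair (cpair z (cpair b (code v))) (cpair (code v) S))
    (cpair (cpair 0 (cpair y (code v))) (cpair (code v) S)).
  elim: a b z => [|a IHa] b z.
    rewrite addn0 => -> z0; apply: run z0 _ _; rewrite gy0 addn0.
    by apply: cmd_while0; rewrite cpairK.
  move=> bay z0; apply: run z0 _ _.
  have gb : 0 < g [tuple of b :: v].
    by rewrite lt0n; apply: contraPneq bay => gb0; have := ymin b; rewrite gb0; lia.
  by rewrite gb addn1; apply: IHa; lia.
apply: cmd_seq (loop y 0 1 _ _) _ => //.
by apply: cmd_op_eq; rewrite /op /= !cpairK.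
Qed.

Theorem compile k (F : k.-tuple nat -> nat) : recursive F ->
  exists p, forall v : k.-tuple nat, computes p (code v) (F v).
Proof.
elim=> {k F} [||k i|k m h g _ [p cp] _ cg|k g h _ [p cp] _ [q cq]|k g g0 _ [p cp]].
- by exists (cpair 2 0) => v S; apply: cmd_op_eq; rewrite /op /= !cpairK.
- exists (cpair 3 0) => v S; apply: cmd_op_eq; rewrite /op /= !cpairK.
  by case/tupleP: v => x v; rewrite /= cpairK -/(thead _) theadE.
- have [p cp] := compile_proj i; exists p => v.
  by rewrite (tnth_nth 0); apply: cp; rewrite size_tuple.
- have [q cq] := compile_args (enum 'I_m) cg.
  exists (cpair 0 (cpair q (cpair 0 (cpair (cpair 8 0)
    (cpair 0 (cpair p (cpair 6 0))))))) => v S.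
  apply: cmd_seq (cq v _) _; set args := [seq _ | _ <- _].
  apply: (cmd_seq (d' := cpair (code args) (cpair (code v) S))).
    by apply: cmd_op_eq; rewrite /op /= !cpairK.
  have -> : args = [tuple g i v | i < m] by rewrite /= /args.
  apply: cmd_seq (cp [tuple g i v | i < m] _) _.
  by apply: cmd_op_eq; rewrite /op /= !cpairK.
- exact: compile_prec cp cq.
- exact: compile_mu cp.
Qed.

(** * A universal function *)

(* The output of program [c] on [i, e, m, pfst t] after [psnd t] steps, or 0 if
   it has not halted by then. *)
Definition univ (c i e m t : nat) : nat :=
  let st := iter (psnd t) step
    (cpair (cpair c 0).+1 (cpair (code [:: i; e; m; pfst t]) 0)) in
  if pfst st == 0 then pfst (psnd (psnd st)) else 0.

(** As [t] codes an argument and a running time, [univ] and [H] have the same suprema, and halting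
    need not be decided: an unfinished run gives the harmless lower bound 0. *)
Lemma univP (H : nat -> nat -> nat -> nat -> nat) :
  rec_in 4 (fun l => H (nth 0 l 0) (nth 0 l 1) (nth 0 l 2) (nth 0 l 3)) ->
  exists c, forall i e m,
    (forall t, univ c i e m t <= H i e m (pfst t)) /\
    (forall s, exists t, univ c i e m t = H i e m s).
Proof.
move=> /compile[c cP]; exists c => i e m.
have halt s : exists n,
    iter n step (cpair (cpair c 0).+1 (cpair (code [:: i; e; m; s]) 0))
    = cpair 0 (cpair (code [:: i; e; m; s]) (cpair (H i e m s) 0)).
  exact: (cP [tuple i; e; m; s] 0 0).
have stay st a : pfst st = 0 -> iter a step st = st.
  by move=> s0; elim: a => //= a ->; rewrite /step s0.
split=> [t|s]; last first.
  have [n nP] := halt s; exists (cpair s n).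
  by rewrite /univ !cpairK nP !cpairK.
have [n nP] := halt (pfst t); rewrite /univ.
set st0 := cpair _ _ in nP *.
have [tn|/ltnW nt] := leqP n (psnd t).
  rewrite -(subnK tn) iterD nP stay ?cpairK //= ?cpairK //.
case: eqP => // st0'.
by move: nP; rewrite -(subnK nt) iterD stay // => ->; rewrite !cpairK.
Qed.

Lemma rec_in_op k A B :
  rec_in k A -> rec_in k B -> rec_in k (fun l => op (A l) (B l)).
Proof.
move=> rA rB; rewrite /op.
have nthr (s : seq (nat -> nat -> nat)) :
    foldr (fun F => and (rec_in 2 (fun l => F (nth 0 l 0) (nth 0 l 1)))) True s ->
    forall J, rec_in k J ->
    rec_in k (fun l => nth (fun _ _ => 0) s (J l) (pfst (B l)) (psnd (B l))).
  elim: s => [_|F s IHs [rF /IHs {}IHs]] J rJ.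
    by apply: rec_in_ext (rec_in_const _ 0) => l _; rewrite nth_nil.
  apply: rec_in_ext (rec_in_if (rec_in_eqn rJ (rec_in_const _ 0))
    (rec_in_op2 rF (rec_in_pfst rB) (rec_in_psnd rB)) (IHs _ (rec_in_pred rJ)))
    => l _.
  by case: (J l).
apply: nthr rA; rewrite /ops /=; do !split; rec_in_auto.
Qed.

Lemma rec_in_step k A : rec_in k A -> rec_in k (fun l => step (A l)).
Proof.
move=> rA; rewrite /step /=; rec_in_auto.
apply: rec_in_op; rec_in_auto.
Qed.

Lemma rec_in_univ k C I E M T : rec_in k C -> rec_in k I -> rec_in k E ->
  rec_in k M -> rec_in k T ->
  rec_in k (fun l => univ (C l) (I l) (E l) (M l) (T l)).
Proof.
move=> rC rI rE rM rT; rewrite /univ /=.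
have rst : rec_in k (fun l => iter (psnd (T l)) step
   (cpair (cpair (C l) 0).+1 (cpair (code [:: I l; E l; M l; pfst (T l)]) 0))).
  apply: (rec_in_iteri (H := fun l => step (nth 0 l 1))); rewrite /=; rec_in_auto.
  by apply: rec_in_step; rec_in_auto.
rec_in_auto.
Qed.

(** * Counting changes and elements by sums *)

Lemma leq_sum_changes (g : nat -> bool) n s :
  ([set t | g t <> g t.+1]%classic #<= `I_n)%card ->
  \sum_(t < s) (g t != g t.+1) <= n.
Proof.
move=> /pcard_leP/unsquash/= h.
pose P : pred 'I_s := fun t => g t != g t.+1.
have -> : \sum_(t < s) (g t != g t.+1) = #|P|.
  rewrite -sum1_card [RHS]big_mkcond; apply: eq_bigr => t _.
  by rewrite unfold_in; case: ifP.
have chP t : t \in P -> [set t | g t <> g t.+1]%classic (val t) by move=> /eqP.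
have hn t : t \in P -> h (val t) < n.
  by move=> /chP tP; have := @funS _ _ _ _ h _ tP.
case: n => [|n] in h hn *.
  rewrite leqn0; apply/eqP/eq_card0 => t; rewrite [RHS]inE.
  by apply: contraTF isT => tP; have := hn t tP.
rewrite -[n.+1]card_ord.
apply: (@leq_card_in _ _ (fun t : 'I_s => inord (h (val t)) : 'I_n.+1)).
move=> t u tP uP /(congr1 (@nat_of_ord _)); rewrite !inordK ?hn // => htu.
by apply/val_inj/(@inj _ _ _ h); rewrite // inE; apply: chP.
Qed.

Lemma card_pred_sum (A : pred nat) m : #|[pred j : 'I_m | A j]| = \sum_(x < m) A x.
Proof.
by rewrite -sum1_card [LHS]big_mkcond; apply: eq_bigr => t _; rewrite inE; case: ifP.
Qed.

(** * Approximations to the rounded suprema and their double limits *)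

(* The index [e = cpair c n] stands for the program [c] and the bound [n <= e].
   When [c] computes [5 ^ e.+1 * N_i m s %/ m], [Phi i e k s] increases with
   [s] to the maximum over [m >= k] of the limits of these values. *)
Definition cap (e : nat) : nat := e * 5 ^ e.+1.

Definition Phi (i e k s : nat) : nat :=
  minn (cap e) (\max_(m < s) \max_(t < s) (k <= m) * univ (pfst e) i e m t).

Lemma Phi_cap i e k s : Phi i e k s <= cap e.
Proof. exact: geq_minl. Qed.

(** Below [cap e] the truncation has no effect, so a bound on [Phi] is a bound on every value
    searched. *)
Lemma Phi_leqP i e k s b : b < cap e -> reflect
  (forall m t, m < s -> t < s -> k <= m -> univ (pfst e) i e m t <= b)
  (Phi i e k s <= b).
Proof.
move=> be; rewrite geq_min (leqNgt (cap e)) be /=.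
apply: (iffP (bigmax_leqP _ _ _)) => [hm m t ms ts km|hm m _].
  have /bigmax_leqP/(_ (Ordinal ts) isT) := hm (Ordinal ms) isT.
  by rewrite km mul1n.
apply/bigmax_leqP => t _; case: (leqP k m) => // km; rewrite mul1n.
exact: hm.
Qed.

Lemma Phi_homo i e k k' s s' : k' <= k -> s <= s' -> Phi i e k s <= Phi i e k' s'.
Proof.
move=> kk ss; have [ge|lt] := leqP (cap e) (Phi i e k' s').
  exact: leq_trans (Phi_cap _ _ _ _) ge.
apply/Phi_leqP => // m t ms ts km.
by have /Phi_leqP := leqnn (Phi i e k' s'); apply=> //; lia.
Qed.

Lemma nondecreasing_stable (u : nat -> nat) b :
  {homo u : m n / m <= n} -> (forall n, u n <= b) ->
  exists N, forall n, N <= n -> u n = u N.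
Proof.
move=> uP ub.
have exv : exists v, `[< exists N, u N = v >].
  by exists (u 0); apply/asboolP; exists 0.
have vb v : `[< exists N, u N = v >] -> v <= b by move=> /asboolP[N <-].
case: (ex_maxnP exv vb) => v /asboolP[N <-] vmax; exists N => n Nn.
apply/eqP; rewrite eqn_leq; apply/andP; split; last exact: uP.
by apply: vmax; apply/asboolP; exists n.
Qed.

Lemma nonincreasing_stable (u : nat -> nat) :
  {homo u : m n / m <= n >-> n <= m} -> exists N, forall n, N <= n -> u n = u N.
Proof.
move=> uP.
have exv : exists v, `[< exists N, u N = v >].
  by exists (u 0); apply/asboolP; exists 0.
case: (ex_minnP exv) => v /asboolP[N <-] vmin; exists N => n Nn.
apply/eqP; rewrite eqn_leq; apply/andP; split; first exact: uP.
by apply: vmin; apply/asboolP; exists n.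
Qed.

Definition Phi_limit i e p := exists k0, forall k, k0 <= k ->
  exists N, forall s, N <= s -> Phi i e k s = p.

Lemma ex_Phi_limit i e : exists p, Phi_limit i e p.
Proof.
have /choice[L LP] k : exists L, exists N, forall s, N <= s -> Phi i e k s = L.
  have [||N NP] := @nondecreasing_stable (Phi i e k) (cap e).
  - by move=> s s'; apply: Phi_homo.
  - exact: Phi_cap.
  by exists (Phi i e k N), N.
(* The inner limits do not increase with [k], and natural numbers cannot decrease forever. *)
have [k k' kk|k0 k0P] := @nonincreasing_stable L.
  have [N NP] := LP k; have [N' NP'] := LP k'.
  rewrite -(NP (maxn N N') (leq_maxl _ _)) -(NP' (maxn N N') (leq_maxr _ _)).
  exact: Phi_homo.
by exists (L k0), k0 => k /k0P <-; exact: LP.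
Qed.

(** * The switches of an n-c.e. set *)

Section Opponent.
Variables (n : nat) (A : pred nat) (g : nat -> nat -> bool).
Hypothesis g_rec : computable2 (fun x s => nat_of_bool (g x s)).
Hypothesis g0 : forall x, g x 0 = false.
Hypothesis gA : forall x, exists N, forall s, N <= s -> g x s = A x.
Hypothesis g_changes : forall x s, \sum_(t < s) (g x t != g x t.+1) <= n.

(* [i = 0] counts switches on, [i > 0] switches off. *)
Definition switches (i m s : nat) : nat :=
  \sum_(x < m) \sum_(t < s) (if i == 0 then g x t.+1 - g x t else g x t - g x t.+1).

(** Starting from off, switches on and off alternate at each [x], so their difference is the current
    value. *)
Lemma switches_sub m s : switches 0 m s = switches 1 m s + \sum_(x < m) g x s.
Proof.
rewrite /switches -big_split; apply: eq_bigr => x _ /=.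
elim: s => [|s IHs]; first by rewrite !big_ord0 g0.
rewrite !big_ord_recr /= IHs; case: (g x s); case: (g x s.+1); lia.
Qed.

Lemma switches_bound i m s : switches i m s <= n * m.
Proof.
rewrite mulnC -[m in m * n](card_ord m) -sum_nat_const; apply: leq_sum => x _.
apply: leq_trans (g_changes x s); apply: leq_sum => t _.
by case: ifP => _; case: (g x t); case: (g x t.+1).
Qed.

Lemma switches_homo i m : {homo switches i m : s s' / s <= s'}.
Proof.
move=> s s' ss; apply: leq_sum => x _.
rewrite (big_ord_widen _
  (fun t => if i == 0 then g x t.+1 - g x t else g x t - g x t.+1) ss).
by rewrite [leqRHS](bigID (fun t : 'I_s' => t < s)) leq_addr.
Qed.

Lemma rec_in_switches :
  rec_in 3 (fun l => switches (nth 0 l 0) (nth 0 l 1) (nth 0 l 2)).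
Proof.
have rg k X T : rec_in k X -> rec_in k T -> rec_in k (fun l => g (X l) (T l)).
  apply: (rec_in_op2 (op := fun x t => g x t)).
  by apply: recursive_ext g_rec => v; rewrite !(tnth_nth 0).
apply: (rec_in_sum (F := fun l => \sum_(t < nth 0 l 3)
  (if nth 0 l 1 == 0 then g (nth 0 l 0) t.+1 - g (nth 0 l 0) t
   else g (nth 0 l 0) t - g (nth 0 l 0) t.+1))); first exact: rec_in_var.
apply: (rec_in_sum (F := fun l =>
  (if nth 0 l 2 == 0 then g (nth 0 l 1) (nth 0 l 0).+1 - g (nth 0 l 1) (nth 0 l 0)
   else g (nth 0 l 1) (nth 0 l 0) - g (nth 0 l 1) (nth 0 l 0).+1))).
  exact: rec_in_var.
by rec_in_auto; apply: rg; rec_in_auto.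
Qed.

(** [p] is the limsup in [m] of the final rounded quotients: an eventual upper bound that is reached
    at arbitrarily large [m]. One [e] serves both kinds of switches because [i] is an argument of
    the program. *)
Lemma opponent_index : exists e, forall i p, Phi_limit i e p ->
  (exists k0, forall m s, k0 <= m -> 5 ^ e.+1 * switches i m s %/ m <= p) /\
  (forall k, exists m s, k < m /\ p <= 5 ^ e.+1 * switches i m s %/ m).
Proof.
(* The precision [5 ^ e.+1] depends on the code of the program itself; with [e] as an argument of
   [H], no fixed point is required. *)
pose H i e m s := 5 ^ e.+1 * switches i m s %/ m.
have [|c cP] := @univP H.
  rewrite /H; rec_in_auto.
  by apply: (rec_in_comp (Gs := [:: nth 0 ^~ 0; nth 0 ^~ 2; nth 0 ^~ 3])
    rec_in_switches) => -[|[|[|]]] //= _; apply: rec_in_var.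
exists (cpair c n) => i p; set e := cpair c n => -[k0 k0P].
(* Since [n <= e], truncation at [cap e] loses nothing. *)
have Hcap m s : H i e m s <= cap e.
  rewrite /H /cap; case: m => [|m]; first by rewrite divn0.
  have bound : 5 ^ e.+1 * switches i m.+1 s <= e * 5 ^ e.+1 * m.+1.
    rewrite mulnAC mulnC leq_mul // (leq_trans (switches_bound _ _ _)) //.
    by rewrite leq_mul //; have /andP[] := leq_cpair c n.
  by rewrite -[leqRHS](mulnK _ (ltn0Sn m)); exact: leq_div2r.
split.
  exists k0 => m s km; have [N NP] := k0P k0 (leqnn _).
  have [t tP] := (cP i e m).2 s.
  (* The stage [S] is past the stabilization of [Phi] and has both [m] and [t] in its search
     range. *)
  set S := (N + m + t).+1; have <- := NP S ltac:(rewrite /S; lia).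
  have [le_cap|lt_cap] := leqP (cap e) (Phi i e k0 S).
    exact: leq_trans (Hcap m s) le_cap.
  rewrite -/(H i e m s) -tP.
  have /Phi_leqP := leqnn (Phi i e k0 S); rewrite /e pfstK.
  by apply; rewrite // /S; lia.
move=> k; have [N NP] := k0P (maxn k.+1 k0) (leq_maxr _ _).
case: p => [|p] in k0P NP *; first by exists k.+1, 0.
(* The limit is now [p.+1]. If no quotient reached it beyond [k], all values searched would be at
   most [p], and so would [Phi]. *)
apply: contrapT => no.
have := leqnn (Phi i e (maxn k.+1 k0) N); rewrite {1}(NP N) //.
rewrite leqNgt => /negP; apply.
have pe : p < cap e by rewrite -(NP N) // Phi_cap.
rewrite ltnS; apply/Phi_leqP => // m t mN tN km.
rewrite leqNgt; apply/negP => lt_p; apply: no; exists m, (pfst t); split.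
  by move: km; rewrite geq_max => /andP[].
apply: leq_trans lt_p _; rewrite /e pfstK; exact: (cP i _ m).1.
Qed.

(** Where one quotient reaches its limsup, the other is bounded by its own; rounding costs the
    successor. The two limsups may be reached at different [m], hence two separate bounds, which
    suffice once the density exists. *)
Lemma opponent_counts : exists e, forall p q, Phi_limit 0 e p -> Phi_limit 1 e q ->
  forall k,
  (exists m, k < m /\ p * m <= 5 ^ e.+1 * #|[pred j : 'I_m | A j]| + q.+1 * m) /\
  (exists m, k < m /\ 5 ^ e.+1 * #|[pred j : 'I_m | A j]| + q * m <= p.+1 * m).
Proof.
have [e eP] := opponent_index.
exists e => p q /eP[[a aP] p_inf] /eP[[b bP] q_inf] k.
have [N NP] := choice gA.
have gsum m s : \max_(x < m) N x <= s ->
    \sum_(x < m) g x s = #|[pred j : 'I_m | A j]|.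
  move=> Ns; rewrite card_pred_sum; apply: eq_bigr => x _; rewrite NP //.
  exact: leq_trans (leq_bigmax x) Ns.
split.
  have [m [s [km pm]]] := p_inf (maxn k b); exists m.
  have [m0 [km' bm]] : 0 < m /\ k < m /\ b <= m by lia.
  (* By stage [S] every [x < m] has settled, and the number of switches has not dropped since stage
     [s]. *)
  split=> //; set S := maxn s (\max_(x < m) N x).
  have := bP m S bm; rewrite -ltnS ltn_divLR //.
  move: pm; rewrite leq_divRL // => pm.
  have : 5 ^ e.+1 * switches 0 m s <= 5 ^ e.+1 * switches 0 m S.
    by rewrite leq_mul //; apply: switches_homo; exact: leq_maxl.
  by rewrite (switches_sub m S) gsum ?leq_maxr // mulnDr; lia.
have [m [s [km pm]]] := q_inf (maxn k a); exists m.
have [m0 [km' bm]] : 0 < m /\ k < m /\ a <= m by lia.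
split=> //; set S := maxn s (\max_(x < m) N x).
have := aP m S bm; rewrite -ltnS ltn_divLR //.
move: pm; rewrite leq_divRL // => pm.
have : 5 ^ e.+1 * switches 1 m s <= 5 ^ e.+1 * switches 1 m S.
  by rewrite leq_mul //; apply: switches_homo; exact: leq_maxl.
by rewrite (switches_sub m S) gsum ?leq_maxr // mulnDr; lia.
Qed.

End Opponent.

(** * Locating the density of an n-c.e. set *)

Section NceDensity.
Variable R : realType.
Import Order.TTheory GRing.Theory Num.Theory.
Import numFieldNormedType.Exports.
Local Open Scope classical_set_scope.
Local Open Scope ring_scope.

(** As the limit exists, a bound at arbitrarily large [m] passes to it. *)
Lemma density_ge (A : pred nat) (a : R) : has_density R A ->
  (forall k, exists m, (k < m)%N /\ a <= partial_density R A m) -> a <= density R A.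
Proof.
move=> cA often; rewrite leNgt; apply/negP => lt_a.
have [k _ kP] : \forall m \near \oo, partial_density R A m < a.
  by apply: (@cvgr_lt _ _ _ _ _ _ cA).
have [m [km]] := often k; rewrite leNgt => /negP; apply.
by apply: kP => /=; exact: ltnW.
Qed.

Lemma density_le (A : pred nat) (a : R) : has_density R A ->
  (forall k, exists m, (k < m)%N /\ partial_density R A m <= a) -> density R A <= a.
Proof.
move=> cA often; rewrite leNgt; apply/negP => lt_a.
have [k _ kP] : \forall m \near \oo, a < partial_density R A m.
  by apply: (@cvgr_gt _ _ _ _ _ _ cA).
have [m [km]] := often k; rewrite leNgt => /negP; apply.
by apply: kP => /=; exact: ltnW.
Qed.

Lemma nce_density n (A : pred nat) : is_nce n A -> has_density R A ->
  exists e, forall p q, Phi_limit 0 e p -> Phi_limit 1 e q ->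
    `|(5 ^ e.+1)%:R * density R A - (p%:R - q%:R)| <= 1.
Proof.
move=> [g [g_rec gP]] cA.
have [|||e eP] := @opponent_counts n A g g_rec.
- by move=> x; have [] := gP x.
- by move=> x; have [_ [N _ NP] _] := gP x; exists N => s Ns; apply: NP.
- by move=> x s; have [_ _] := gP x; exact: leq_sum_changes.
exists e => p q pP qP; have {eP} cnt := eP p q pP qP.
set D : R := (5 ^ e.+1)%:R.
have D0 : 0 < D by rewrite ltr0n expn_gt0.
have lo : (p%:R - q.+1%:R) / D <= density R A.
  apply: density_ge => // k; have [[m [km mP]] _] := cnt k; exists m; split=> //.
  have m0 : 0 < m%:R :> R by rewrite ltr0n (leq_ltn_trans _ km).
  rewrite /partial_density ler_pdivrMr // mulrAC ler_pdivlMr // mulrBl lerBlDr.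
  rewrite [X in _ <= X + _]mulrC.
  by rewrite -!natrM -natrD ler_nat.
have hi : density R A <= (p.+1%:R - q%:R) / D.
  apply: density_le => // k; have [_ [m [km mP]]] := cnt k; exists m; split=> //.
  have m0 : 0 < m%:R :> R by rewrite ltr0n (leq_ltn_trans _ km).
  rewrite /partial_density ler_pdivlMr // mulrAC ler_pdivrMr // mulrBl lerBrDr.
  rewrite [X in X + _]mulrC.
  by rewrite -!natrM -natrD ler_nat.
move: lo hi; rewrite ler_pdivrMr // ler_pdivlMr // [density R A * _]mulrC -!natr1.
move=> lo hi.
by rewrite ler_norml; apply/andP; split; lra.
Qed.

End NceDensity.

(** * The diagonal set and its approximation *)

(** Sending a change [s] to [psi s] is injective, with values below [n]. *)
Lemma card_changes_le (g : nat -> bool) (psi : nat -> nat) n :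
  {homo psi : s s' / s <= s'} -> (forall s, psi s <= n) ->
  (forall s, g s <> g s.+1 -> psi s < psi s.+1) ->
  ([set s | g s <> g s.+1]%classic #<= `I_n)%card.
Proof.
move=> psi_homo psi_n psi_g; set A := [set s | _]%classic.
have psi_inj : {in A &, injective psi}.
  move=> s s'; rewrite !inE => /psi_g ss /psi_g ss' eq_psi.
  have [lt|lt|//] := ltngtP s s'; move: lt => /psi_homo; lia.
rewrite -(card_le_eql (inj_card_eq psi_inj)).
by apply: subset_card_le => _ [s /psi_g sA <-] /=; apply: leq_trans sA _.
Qed.

Lemma logn_sum x : logn 5 x = \sum_(j < x) (5 ^ j.+1 %| x).
Proof.
case: x => [|x]; first by rewrite big_ord0.
under eq_bigr => j _ do rewrite pfactor_dvdn //.
rewrite -[LHS]card_ord -sum1_card.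
rewrite (big_ord_widen _ (fun=> 1) (ltnW (ltn_logl 5 (ltn0Sn x)))).
by rewrite big_mkcond; apply: eq_bigr => j _; case: ltnP.
Qed.

Lemma rec_in_logn5 k X : rec_in k X -> rec_in k (fun l => logn 5 (X l)).
Proof.
apply: (rec_in_op1 (op := logn 5)).
apply: rec_in_ext (@rec_in_sum 1 (nth 0 ^~ 0)
  (fun l => 5 ^ (nth 0 l 0).+1 %| nth 0 l 1) _ _); rec_in_auto.
by move=> l _; rewrite logn_sum.
Qed.

Lemma rec_in_Phi k I E K S : rec_in k I -> rec_in k E -> rec_in k K -> rec_in k S ->
  rec_in k (fun l => Phi (I l) (E l) (K l) (S l)).
Proof.
move=> rI rE rK rS.
have rPhi : rec_in 4 (fun l => Phi (nth 0 l 0) (nth 0 l 1) (nth 0 l 2) (nth 0 l 3)).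
  rewrite /Phi /cap; apply: rec_in_minn; first by rec_in_auto.
  apply: (@rec_in_bigmax 4 (nth 0 ^~ 3) (fun l => \max_(t < nth 0 l 4)
    (nth 0 l 3 <= nth 0 l 0) *
      univ (pfst (nth 0 l 2)) (nth 0 l 1) (nth 0 l 2) (nth 0 l 0) t)).
    by rec_in_auto.
  apply: (@rec_in_bigmax 5 (nth 0 ^~ 4) (fun l => (nth 0 l 4 <= nth 0 l 1) *
    univ (pfst (nth 0 l 3)) (nth 0 l 2) (nth 0 l 3) (nth 0 l 1) (nth 0 l 0))).
    by rec_in_auto.
  by rec_in_auto; apply: rec_in_univ; rec_in_auto.
by apply: (rec_in_comp (Gs := [:: I; E; K; S]) rPhi) => -[|[|[|[|]]]].
Qed.

(* A real in [[5 z + digit p q, 5 z + digit p q + 1]], for [z] an integer, is at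
   distance at least 2 from [p - q]. *)
Definition digit (p q : nat) : nat := (p + 4 * q + 2) %% 5.

Definition in_class (b e x : nat) : bool := 0 < (x %/ 5 ^ e) %% 5 <= b.

(** Stage 0 must be empty, so the approximations are read one stage late. The budget covers
    [2 * cap e] changes of the two [Phi] and one on leaving stage 0. *)
Definition diag (f : nat -> nat) (x s : nat) : bool :=
  let e := logn 5 x in
  [&& 0 < s, (2 * cap e).+1 <= f x &
   in_class (digit (Phi 0 e x s.-1) (Phi 1 e x s.-1)) e x].

Lemma diag_computable f : computable1 f ->
  computable2 (fun x s => diag f x s).
Proof.
move=> rf.
have rf1 k X : rec_in k X -> rec_in k (fun l => f (X l)).
  apply: rec_in_op1; apply: recursive_ext rf => v.
  by rewrite (tnth_nth 0).
have : rec_in 2 (fun l => diag f (nth 0 l 0) (nth 0 l 1)).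
  rewrite /diag /in_class /digit /cap /=; rec_in_auto;
    try by apply: rec_in_logn5; rec_in_auto.
  - by apply: rf1; rec_in_auto.
  - by apply: rec_in_Phi; rec_in_auto; apply: rec_in_logn5; rec_in_auto.
  - by apply: rec_in_Phi; rec_in_auto; apply: rec_in_logn5; rec_in_auto.
by apply: recursive_ext => v; rewrite !(tnth_nth 0).
Qed.

Lemma diag_changes f x :
  ([set s | diag f x s <> diag f x s.+1]%classic #<= `I_(f x))%card.
Proof.
set e := logn 5 x; have [budget|over] := leqP (2 * cap e).+1 (f x); last first.
  have -> : [set s | diag f x s <> diag f x s.+1]%classic = set0.
    by apply/seteqP; split=> // s /=; rewrite /diag -/e !(ltn_geF over) !andbF.
  exact: card_ge0.
pose total s := Phi 0 e x s + Phi 1 e x s.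
pose psi s := if s is s'.+1 then (total s').+1 else 0.
have total_homo s s' : s <= s' -> total s <= total s'.
  by move=> ss; rewrite leq_add ?Phi_homo.
apply: (@card_changes_le _ psi).
- by move=> [|s] [|s'] //= ss; rewrite ltnS total_homo.
- move=> [|s] //=; apply: leq_trans budget; rewrite ltnS mul2n -addnn.
  by rewrite leq_add ?Phi_cap.
move=> [|s] // ch; rewrite /psi ltnS ltn_neqAle total_homo // andbT.
(* Both [Phi] are nondecreasing, so an unchanged sum leaves each of them unchanged. *)
apply: contra_not_neq ch => eq_total.
have le0 := @Phi_homo 0 e x x s s.+1 (leqnn _) (leqnSn _).
have le1 := @Phi_homo 1 e x x s s.+1 (leqnn _) (leqnSn _).
rewrite /diag -/e /=.
have -> : Phi 0 e x s.+1 = Phi 0 e x s by move: eq_total; rewrite /total; lia.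
by have -> : Phi 1 e x s.+1 = Phi 1 e x s by move: eq_total; rewrite /total; lia.
Qed.

Lemma diag_limit f : exists B : pred nat,
  forall x, exists N, forall s, N <= s -> diag f x s = B x.
Proof.
suff /choice[B BP] x : exists v, exists N, forall s, N <= s -> diag f x s = v.
  by exists B.
set e := logn 5 x.
have stable i : exists N, forall s, N <= s -> Phi i e x s = Phi i e x N.
  apply: (@nondecreasing_stable _ (cap e)) => [s s'|s]; first exact: Phi_homo.
  exact: Phi_cap.
have [N NP] := stable 0; have [M MP] := stable 1.
exists (diag f x (N + M).+1), (N + M).+1 => -[//|s] NMs.
by rewrite /diag -/e /= !(NP, MP) //; lia.
Qed.

(** For fixed [e], large [x] pass the budget test because [f] tends to infinity, and [k = x] is past
    the point where both outer limits are reached. *)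
Lemma diag_limitE f (B : pred nat) e p q :
  {homo f : x y / x <= y} -> (forall k, exists x, k < f x) ->
  (forall x, exists N, forall s, N <= s -> diag f x s = B x) ->
  Phi_limit 0 e p -> Phi_limit 1 e q ->
  exists k, forall x, k <= x -> logn 5 x = e -> B x = in_class (digit p q) e x.
Proof.
move=> f_homo f_unb BP [k0 k0P] [k1 k1P]; have [k2 k2P] := f_unb (2 * cap e).
exists (k0 + k1 + k2) => x kx xe.
have [N NP] := BP x.
have [N0 N0P] := k0P x ltac:(lia); have [N1 N1P] := k1P x ltac:(lia).
rewrite -(NP (N + N0 + N1).+1); last lia.
rewrite /diag xe /= N0P ?N1P; try lia.
by rewrite (leq_trans k2P) // f_homo //; lia.
Qed.

(** * Rulers, the sets contributed by single digits *)

(** Divisibility stands in for [logn 5 x = e], as the digit in position [e] is nonzero; this form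
    shows the period [5 ^ e.+1]. *)
Definition ruler (b e x : nat) : bool := (5 ^ e %| x) && in_class b e x.

Lemma sum_pred_leq (A : pred nat) m : \sum_(x < m) A x <= m.
Proof. by rewrite -card_pred_sum -[leqRHS]card_ord max_card. Qed.

Lemma sum_periodic (A : pred nat) P y : (forall x, A (x + P) = A x) ->
  \sum_(x < y * P) A x = y * \sum_(x < P) A x.
Proof.
move=> AP; elim: y => [|y IHy]; first by rewrite big_ord0.
rewrite mulSnr big_split_ord /= IHy mulSnr; congr (_ + _).
apply: eq_bigr => x _ /=; elim: y {IHy} => // y <-.
by rewrite mulSnr addnAC AP.
Qed.

Lemma sum_multiples (F : nat -> nat) d n : 0 < d ->
  \sum_(x < n * d) (d %| x) * F (x %/ d) = \sum_(j < n) F j.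
Proof.
case: d => // d _; elim: n => [|n IHn]; first by rewrite !big_ord0.
rewrite mulSnr big_split_ord /= IHn [RHS]big_ord_recr /=; congr (_ + _).
rewrite big_ord_recl /= addn0 dvdn_mull // mulnK // mul1n big1 ?addn0 // => i _.
by rewrite dvdn_addr ?dvdn_mull // gtnNdvd // ltnS; exact: ltn_ord.

Qed.

Lemma sum_ruler b e : b < 5 -> \sum_(x < 5 ^ e.+1) ruler b e x = b.
Proof.
move=> b5; rewrite expnS.
transitivity (\sum_(x < 5 * 5 ^ e) (5 ^ e %| x) * (0 < (x %/ 5 ^ e) %% 5 <= b)).
  by apply: eq_bigr => x _; rewrite mulnb.
rewrite (sum_multiples (fun j => 0 < j %% 5 <= b)) ?expn_gt0 //.
by case: b b5 => [|[|[|[|[|]]]]] // _; rewrite !big_ord_recl big_ord0.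
Qed.

Lemma ruler_periodic b e x : ruler b e (x + 5 ^ e.+1) = ruler b e x.
Proof.
rewrite /ruler /in_class expnS dvdn_addl ?dvdn_mull //.
by rewrite divnDMl ?expn_gt0 // modnDr.
Qed.

Lemma ruler_logn b e x : 0 < x -> ruler b e x = (logn 5 x == e) && in_class b e x.
Proof.
move=> x0; rewrite /ruler /in_class.
case: (ltnP 0 ((x %/ 5 ^ e) %% 5)) => [d0|]; last by rewrite !andbF.
congr andb; rewrite pfactor_dvdn // eqn_leq.
case: (leqP e) => [le_e|]; rewrite ?andbF // andbT; apply/esym; rewrite leqNgt.
apply/negP => lt_e; move: d0; rewrite lt0n => /negP; apply.
have : 5 ^ e.+1 %| x by rewrite pfactor_dvdn.
by rewrite expnS => /dvdnP[z ->]; rewrite mulnA mulnK ?expn_gt0 // modnMl.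
Qed.

Section RulerApprox.
Variables (b : nat -> nat) (B : pred nat).
Hypothesis b5 : forall e, b e < 5.
Hypothesis B_limit : forall e,
  exists k, forall x, k <= x -> logn 5 x = e -> B x = in_class (b e) e x.

(** Up to finitely many exceptions, [B] agrees with the disjoint union of the first [E] rulers
    outside the multiples of [5 ^ E]. *)
Lemma ruler_approx E : exists C, forall m,
  \sum_(e < E) \sum_(x < m) ruler (b e) e x <= \sum_(x < m) B x + C /\
  \sum_(x < m) B x <= \sum_(e < E) \sum_(x < m) ruler (b e) e x
    + \sum_(x < m) (5 ^ E %| x) + C.
Proof.
have [k kP] := choice B_limit; pose C := (\max_(e < E) k e).+1.
(* At each [x < C] the smaller side, a sum of [E] rulers or a value of [B], is at most [E.+1]. *)
exists (E.+1 * C) => m.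
have pointwise x : C <= x ->
    \sum_(e < E) ruler (b e) e x <= B x <= \sum_(e < E) ruler (b e) e x + (5 ^ E %| x).
  move=> Cx; have x0 : 0 < x by apply: leq_trans Cx.
  under eq_bigr => e _ do rewrite ruler_logn //.
  rewrite pfactor_dvdn //; have [le_E|lt_E] := leqP E (logn 5 x).
    rewrite big1 => [|e _]; first by case: (B x).
    by rewrite gtn_eqF // (leq_trans (ltn_ord e)).
  rewrite (bigD1 (Ordinal lt_E)) //= eqxx big1 => [|e]; last first.
    by rewrite -val_eqE /= eq_sym => /negPf ->.
  rewrite !addn0 (kP _ _ _ (erefl (logn 5 x))) ?leqnn //.
  apply: leq_trans Cx; exact/ltnW/(leq_bigmax (Ordinal lt_E)).
have small (F G : nat -> nat) :
    (forall x, C <= x -> F x <= G x) -> (forall x, F x <= E.+1) ->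
    \sum_(x < m) F x <= \sum_(x < m) G x + E.+1 * C.
  move=> FG FE; apply: (@leq_trans (\sum_(x < m) (G x + E.+1 * (x < C)))).
    apply: leq_sum => x _; have [xC|Cx] := ltnP x C; last by rewrite muln0 addn0 FG.
    by rewrite muln1 (leq_trans (FE x)) // leq_addl.
  rewrite big_split /= -big_distrr /= leq_add2l leq_mul //.
  have -> : \sum_(x < m) (x < C) = minn m C.
    by elim: (m) => [|n IHn]; rewrite ?big_ord0 ?min0n // big_ord_recr /= IHn; lia.
  exact: geq_minr.
have ruler_E x : \sum_(e < E) ruler (b e) e x <= E.
  exact: (sum_pred_leq (fun e => ruler (b e) e x)).
rewrite exchange_big -big_split /=; split.
  apply: (small (fun x => \sum_(e < E) ruler (b e) e x) B) => x.
    by move=> /pointwise /andP[].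
  exact: leq_trans (leqnSn _).
apply: (small B (fun x => \sum_(e < E) ruler (b e) e x + (5 ^ E %| x))) => x.
  by move=> /pointwise /andP[].
by case: (B x).
Qed.
End RulerApprox.

(** * Density of periodic sets *)

Section PeriodicDensity.
Variable R : realType.
Import Order.TTheory GRing.Theory Num.Theory.
Import numFieldNormedType.Exports.
Local Open Scope classical_set_scope.
Local Open Scope ring_scope.

Lemma cvg_div_nat (c : R) : c / m%:R @[m --> \oo] --> (0 : R).
Proof.
rewrite -[X in _ --> X](mulr0 c); apply: cvgM; first exact: cvg_cst.
apply/cvgrPdist_le => eps eps0; near=> m.
have m0 : 0 < m%:R :> R by near: m; exists 1%N => // m; rewrite /= ltr0n.
rewrite sub0r normrN gtr0_norm ?invr_gt0 // invf_ple ?posrE //.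
by near: m; exact: nbhs_infty_ger.
Unshelve. all: by end_near. Qed.

Lemma periodic_density (A : pred nat) P :
  (0 < P)%N -> (forall x, A (x + P)%N = A x) ->
  partial_density R A m @[m --> \oo] --> ((\sum_(x < P) A x)%N%:R / P%:R : R).
Proof.
move=> P0 AP; set c := (\sum_(x < P) A x)%N.
have cP : (c <= P)%N by exact: sum_pred_leq.
(* The incomplete last period costs at most [P / m]. *)
have bound m : (0 < m)%N -> c%:R / P%:R - P%:R / m%:R <= partial_density R A m
    <= c%:R / P%:R + P%:R / m%:R.
  move=> m0; rewrite /partial_density card_pred_sum; set S := (\sum_(x < m) A x)%N.
  have [y [r [my rP]]] : exists y r, m = (y * P + r)%N /\ (r < P)%N.
    by exists (m %/ P)%N, (m %% P)%N; rewrite -divn_eq ltn_mod.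
  have [lo hi] : (y * c <= S)%N /\ (S <= y * c + r)%N.
    rewrite /S my big_split_ord /= sum_periodic // leq_addr leq_add2l; split=> //.
    exact: (sum_pred_leq (fun x => A (y * P + x)%N)).
  have PR : 0 < P%:R :> R by rewrite ltr0n.
  have mR : 0 < m%:R :> R by rewrite ltr0n.
  have eq1 : c%:R / P%:R = c%:R * m%:R / P%:R / m%:R :> R by field; rewrite !gt_eqF.
  rewrite eq1 -mulrBl -mulrDl !ler_pM2r ?invr_gt0 //.
  have cr : (c * r <= P * P)%N by rewrite leq_mul // ltnW.
  apply/andP; split.
    rewrite lerBlDr ler_pdivrMr // mulrDl -!natrM -natrD ler_nat my; nia.
  rewrite -lerBlDr ler_pdivlMr // mulrBl lerBlDr -!natrM -natrD ler_nat my; nia.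
apply: (@squeeze_cvgr _ _ _ _ (fun m => c%:R / P%:R - P%:R / m%:R)
  (fun m => c%:R / P%:R + P%:R / m%:R)).
- by exists 1%N => // m; exact: bound.
- rewrite -[X in _ --> X]subr0; apply: cvgB; [exact: cvg_cst|exact: cvg_div_nat].
- rewrite -[X in _ --> X]addr0; apply: cvgD; [exact: cvg_cst|exact: cvg_div_nat].
Qed.
End PeriodicDensity.

(** * The density of the diagonal set in base 5 *)

Section Digits.
Variable R : realType.
Import Order.TTheory GRing.Theory Num.Theory.
Import numFieldNormedType.Exports.
Local Open Scope classical_set_scope.
Local Open Scope ring_scope.
Variables (b : nat -> nat) (B : pred nat).
Hypothesis b5 : forall e, (b e < 5)%N.
Hypothesis B_limit : forall e, exists k, forall x, (k <= x)%N ->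
  logn 5 x = e -> B x = in_class (b e) e x.

Let pow e : R := (5 ^ e)%:R.
Definition truncation E : R := \sum_(e < E) (b e)%:R / pow e.+1.

Let pow_gt0 e : 0 < pow e.
Proof. by rewrite ltr0n expn_gt0. Qed.

Let powS e : pow e.+1 = 5 * pow e.
Proof. by rewrite /pow expnS natrM. Qed.

Lemma truncationS E : truncation E.+1 = truncation E + (b E)%:R / pow E.+1.
Proof. by rewrite /truncation big_ord_recr. Qed.

Lemma truncation_homo : {homo truncation : m n / (m <= n)%N >-> m <= n}.
Proof.
apply: homo_leq => [//|x y z|E]; first exact: le_trans.
by rewrite truncationS lerDl divr_ge0 // ltW.
Qed.

(** As digits are at most 4, [(b E).+1 / 5 ^ E.+1 <= 1 / 5 ^ E], so the upper bounds
    [truncation E + (pow E)^-1] never increase. *)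
Lemma truncation_tail E n :
  truncation (E + n) + (pow (E + n))^-1 <= truncation E + (pow E)^-1.
Proof.
elim: n => [|n IHn]; first by rewrite addn0.
apply: le_trans IHn; rewrite addnS truncationS -addrA lerD2l powS.
have -> : (pow (E + n))^-1 = 5 / (5 * pow (E + n)) by field; rewrite gt_eqF.
rewrite -[X in _ + X]mul1r -mulrDl ler_pM2r ?invr_gt0 ?mulr_gt0 //.
by rewrite natr1 ler_nat; exact: b5.
Qed.

Lemma truncation_le E n : truncation n <= truncation E + (pow E)^-1.
Proof.
have tail0 k : 0 <= (pow k)^-1 by rewrite invr_ge0 ltW.
have [nE|/ltnW/subnKC <-] := leqP n E.
  by apply: le_trans (truncation_homo nE) _; rewrite lerDl.
by apply: le_trans (truncation_tail E (n - E)); rewrite lerDl.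
Qed.

Let r := limn truncation.

Lemma truncation_cvg : cvgn truncation.
Proof.
apply: nondecreasing_is_cvgn; first exact: truncation_homo.
by exists (truncation 0 + (pow 0)^-1) => _ [n _ <-]; exact: truncation_le.
Qed.

Lemma truncation_lim_bounds E : truncation E <= r <= truncation E + (pow E)^-1.
Proof.
apply/andP; split.
  exact: nondecreasing_cvgn_le truncation_homo truncation_cvg E.
apply: limr_le; first exact: truncation_cvg.
by near=> n; exact: truncation_le.
Unshelve. all: by end_near. Qed.

Lemma rulers_cvg E :
  (\sum_(e < E) partial_density R (ruler (b e) e) m) @[m --> \oo] --> truncation E.
Proof.
elim: E => [|E IHE].
  rewrite /truncation big_ord0; under eq_fun do rewrite big_ord0.
  exact: cvg_cst.
rewrite truncationS; under eq_fun do rewrite big_ord_recr /=.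
apply: cvgD IHE _.
have := @periodic_density R (ruler (b E) E) (5 ^ E.+1) _ (ruler_periodic _ _).
by rewrite expn_gt0 sum_ruler // => /(_ isT).
Qed.

Lemma multiples_cvg E :
  partial_density R (dvdn (5 ^ E)) m @[m --> \oo] --> ((pow E)^-1 : R).
Proof.
have E0 : (0 < 5 ^ E)%N by rewrite expn_gt0.
have := @periodic_density R (dvdn (5 ^ E)) _ E0 (fun x => dvdn_addl _ (dvdnn _)).
have -> : (\sum_(x < 5 ^ E) (5 ^ E %| x) = 1)%N.
  have := sum_multiples (fun=> 1%N) 1 E0; rewrite mul1n big_ord1 => sum1.
  by rewrite -[RHS]sum1; apply: eq_bigr => x _; rewrite muln1.
by rewrite mul1r.
Qed.

Lemma digits_cvg : partial_density R B m @[m --> \oo] --> r.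
Proof.
apply/cvgrPdist_le => eps eps0.
(* Half of [eps] covers the multiples of [5 ^ E], the other half the convergence for this fixed
   [E]. *)
have [E Eeps] : exists E, (pow E)^-1 <= eps / 2.
  have [N _ NP] := nbhs_infty_ger (eps / 2)^-1.
  exists N; rewrite invf_ple ?posrE ?divr_gt0 //.
  apply: le_trans (NP N (leqnn N)) _.
  by rewrite ler_nat ltnW // ltn_expl.
have /andP[r_lo r_hi] := truncation_lim_bounds E.
have [C CP] := ruler_approx B_limit E.
set u := fun m => \sum_(e < E) partial_density R (ruler (b e) e) m.
have uE m : u m = (\sum_(e < E) \sum_(x < m) ruler (b e) e x)%N%:R / m%:R.
  rewrite natr_sum mulr_suml; apply: eq_bigr => e _.
  by rewrite /partial_density card_pred_sum.
have sandwich m : u m - C%:R / m%:R <= partial_density R B m <=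
    u m + partial_density R (dvdn (5 ^ E)) m + C%:R / m%:R.
  have [lo hi] := CP m.
  rewrite uE /partial_density !card_pred_sum -mulrBl -!mulrDl -!natrD.
  by rewrite !ler_wpM2r ?invr_ge0 // ?lerBlDr -?natrD ler_nat.
have lo_cvg : u m - C%:R / m%:R @[m --> \oo] --> truncation E.
  by rewrite -[X in _ --> X]subr0; apply: cvgB; [exact: rulers_cvg|exact: cvg_div_nat].
have hi_cvg : u m + partial_density R (dvdn (5 ^ E)) m + C%:R / m%:R @[m --> \oo]
    --> truncation E + (pow E)^-1.
  rewrite -[X in _ --> X]addr0; apply: cvgD; last exact: cvg_div_nat.
  by apply: cvgD; [exact: rulers_cvg|exact: multiples_cvg].
near=> m.
have lo_m : truncation E - eps / 2 < u m - C%:R / m%:R.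
  by near: m; apply: (cvgr_gt _ lo_cvg); rewrite ltrBlDr ltrDl divr_gt0.
have hi_m : u m + partial_density R (dvdn (5 ^ E)) m + C%:R / m%:R
    < truncation E + (pow E)^-1 + eps / 2.
  by near: m; apply: (cvgr_lt _ hi_cvg); rewrite ltrDl divr_gt0.
have /andP[] := sandwich m.
by rewrite ler_norml => lo hi; apply/andP; split; lra.
Unshelve. all: by end_near. Qed.

Lemma truncation_scaled E : exists K, pow E * truncation E = K%:R.
Proof.
elim: E => [|E [K KP]]; first by exists 0%N; rewrite /truncation big_ord0 mulr0.
exists (5 * K + b E)%N; rewrite truncationS mulrDr mulrCA mulfV ?gt_eqF // mulr1.
by rewrite powS -mulrA KP natrD natrM.
Qed.

(** [K] collects the digits before position [e]. The interval is closed on the right because a tail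
    of digits 4 is not excluded. *)
Lemma digits_density : has_density R B /\ forall e, exists K,
  (5 * K + b e)%:R <= pow e.+1 * density R B <= (5 * K + b e).+1%:R.
Proof.
split; first by apply/cvg_ex; exists r; exact: digits_cvg.
move=> e; rewrite /density (cvg_lim _ digits_cvg) //.
have [K KP] := truncation_scaled e; exists K.
have scaled : (5 * K + b e)%:R = pow e.+1 * truncation e.+1.
  rewrite truncationS mulrDr mulrCA mulfV ?gt_eqF // mulr1.
  by rewrite powS -mulrA KP natrD natrM.
have /andP[lo hi] := truncation_lim_bounds e.+1.
rewrite -natr1 scaled ler_pM2l // lo /=.
have -> : pow e.+1 * truncation e.+1 + 1 =
    pow e.+1 * (truncation e.+1 + (pow e.+1)^-1).
  by rewrite mulrDr mulfV ?gt_eqF.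
by rewrite ler_pM2l.
Qed.
End Digits.

(** * The diagonal argument *)

Theorem corollary5p3 (R : realType) (f : nat -> nat)
    (f_computable : computable1 f)
    (f_nondecreasing : {homo f : x y / x <= y})
    (f_unbounded : forall k : nat, exists x : nat, k < f x) :
  exists B : pred nat,
    [/\ is_fce f B,
        has_density R B &
        forall n : nat,
          ~ exists A : pred nat,
              [/\ is_nce n A, has_density R A & density R A = density R B]].
Proof.
have [B BP] := diag_limit f.
(* The digits come from the true limits and need not be computable; only their approximation in
   [diag] is. *)
have [p pP] := choice (ex_Phi_limit 0); have [q qP] := choice (ex_Phi_limit 1).
pose b e := digit (p e) (q e).
have b5 e : b e < 5 by rewrite /b /digit ltn_mod.
have B_limit e := diag_limitE f_nondecreasing f_unbounded BP (pP e) (qP e).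
have [B_dens digits] := digits_density R b5 B_limit.
exists B; split=> //.
  exists (diag f); split; first exact: diag_computable.
  move=> x; split; [by [] | | exact: diag_changes].
  by have [N NP] := BP x; exists N.
move=> n [A [A_nce A_dens eq_dens]].
have [e /(_ _ _ (pP e) (qP e))] := nce_density A_nce A_dens.
rewrite eq_dens; have [K] := digits e.
set D := GRing.mul _ _ => /andP[lo hi].
rewrite Num.Theory.ler_norml => /andP[lo' hi'].
have : 5 * K + b e + q e <= p e + 1.
  by rewrite -(Num.Theory.ler_nat R) !GRing.natrD; lra.
have : p e <= (5 * K + b e).+1 + q e + 1.
  by rewrite -(Num.Theory.ler_nat R) !GRing.natrD; lra.
(* The two inequalities put [5 * K + b e - (p e - q e)] between -2 and 1, but by the choice of
   [digit] it is 2 modulo 5. *)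
have := divn_eq (p e + 4 * q e + 2) 5; rewrite -/(digit _ _) -/(b e); lia.
Qed.
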